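(* Let $P$ be a program calling a library $L$ whose code is missing, where library functions contain no allocations, no field is accessed by both $P$ and $L$, and there are no callbacks. Let $M_{\text{alloc}}=\mathcal{O}$ be the set of all allocation statements of $P$ and $M_{\text{call}}=\{x\gets m(y)\mid m\in\mathcal{M}\}$ the set of all statements of $P$ that call library functions. Then the monitoring scheme $M_{\text{min}}=M_{\text{alloc}}\cup M_{\text{call}}$ is sound.
   Context: Programs. The available program $P$ is a finite set of statements over a finite set $\mathcal{V}_P$ of program (visible) variables: allocations $x\gets X()$ ($X$ a class), assignments $x\gets y$, loads $x\gets y.f$, stores $x.f\gets y$ ($f$ a field), and library calls $x\gets m(y)$, where $m\in\mathcal{M}$ is a function of the library $L$ (each has exactly one parameter $p_m$ and a return value $r_m$). $P$ contains no functions of its own. Control flow is not modelled: an execution runs some finite sequence of statements of $P$, starting with all variables null. Library functions are implemented by statements of the same kinds over their own variables (disjoint from $\mathcal{V}_P$). A call $x\gets m(y)$ assigns $y$ to $p_m$, runs the body of $m$, and then assigns $r_m$ to $x$. Standing assumptions: library functions contain no allocation statements; disjoint fields, i.e. no field is accessed both by a load or store of $P$ and by a load or store of the library; no callbacks from the library into $P$. Objects. An abstract object $o\in\mathcal{O}$ is an allocation statement $o=(x\gets X())$ of $P$. Each time it is executed it creates a fresh concrete object $\bar o$, said to be allocated at $o$ (written $\bar o\leadsto o$). The dynamic points-to edge $x\hookrightarrow o$ ($x\in\mathcal{V}_P$) occurs in an execution if at some point $x$ points to a concrete object allocated at $o$. Static analysis. Given a set of known counterexamples $\Pi_{\text{miss}}\subseteq\mathcal{V}_P\times\mathcal{O}$,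 the computed set $\Pi\subseteq\mathcal{V}_P\times\mathcal{O}$ is the least set such that: (1) if $o=(x\gets X())$ is in $P$ then $x\hookrightarrow o\in\Pi$; (2) if $x\gets y$ is in $P$ and $y\hookrightarrow o\in\Pi$ then $x\hookrightarrow o\in\Pi$; (3) if $x\gets y.f$ and $z.f\gets w$ are in $P$ and $y\hookrightarrow o',z\hookrightarrow o',w\hookrightarrow o\in\Pi$ then $x\hookrightarrow o\in\Pi$; (4) $\Pi_{\text{miss}}\subseteq\Pi$. Library calls are treated as no-ops. A counterexample (missing points-to edge) in an execution is a dynamic points-to edge $x\hookrightarrow o$ occurring in it with $x\hookrightarrow o\notin\Pi$, where $\Pi$ is the current computed set. Monitoring. A monitoring scheme $M$ is a set of statements of $P$ of the form $x\gets *$. Each time a statement in $M$ is executed, the pair $(x\gets *,\bar o)$ is recorded, where $\bar o$ is the concrete object $x$ points to afterwards. A recorded pair $(x\gets X(),\bar o)$ reveals $\bar o\leadsto o=(x\gets X())$. For every recorded pair $(x\gets *,\bar o)$ with $\bar o\leadsto o$ revealed in the same execution, the edge $x\hookrightarrow o$ is detected, and if it is not in $\Pi$ it is reported. $M$ is sound if (i) for any execution in which some counterexamples occur, $M$ reports one of them, and (ii) $M$ only reports counterexamples. *)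

(* Defs.v *)
From HB Require Import structures.
From Stdlib Require List.
From mathcomp Require Import all_boot finmap.

Set Implicit Arguments.
Unset Strict Implicit.
Unset Printing Implicit Defensive.

Local Open Scope fset_scope.
Local Open Scope fmap_scope.

Section Statements.

Variables (Var Cls Fld Meth : choiceType).

Inductive stmt : Type :=
| SAlloc of Var & Cls          (* x <- X()  *)
| SAssign of Var & Var         (* x <- y    *)
| SLoad of Var & Var & Fld     (* x <- y.f  *)
| SStore of Var & Fld & Var    (* x.f <- y  *)
| SCall of Var & Meth & Var.   (* x <- m(y) *)

Definition stmt_encode (c : stmt) :
    (Var * Cls + Var * Var) + (Var * Var * Fld + Var * Fld * Var)
    + Var * Meth * Var :=
  match c with
  | SAlloc x X => inl (inl (inl (x, X)))
  | SAssign x y => inl (inl (inr (x, y)))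
  | SLoad x y f => inl (inr (inl (x, y, f)))
  | SStore x f y => inl (inr (inr (x, f, y)))
  | SCall x m y => inr (x, m, y)
  end.

Definition stmt_decode
    (e : (Var * Cls + Var * Var) + (Var * Var * Fld + Var * Fld * Var)
         + Var * Meth * Var) : stmt :=
  match e with
  | inl (inl (inl (x, X))) => SAlloc x X
  | inl (inl (inr (x, y))) => SAssign x y
  | inl (inr (inl (x, y, f))) => SLoad x y f
  | inl (inr (inr (x, f, y))) => SStore x f y
  | inr (x, m, y) => SCall x m y
  end.

Lemma stmt_encodeK : cancel stmt_encode stmt_decode.
Proof. by case. Qed.

HB.instance Definition _ := Choice.copy stmt (can_type stmt_encodeK).

Definition stmt_vars (c : stmt) : seq Var :=
  match c with
  | SAlloc x _ => [:: x]
  | SAssign x y | SLoad x y _ | SStore x _ y | SCall x _ y => [:: x; y]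
  end.

(* The variable x of a statement of the form x <- *, if it has that form. *)
Definition stmt_target (c : stmt) : option Var :=
  match c with
  | SAlloc x _ | SAssign x _ | SLoad x _ _ | SCall x _ _ => Some x
  | SStore _ _ _ => None
  end.

Definition stmt_field (c : stmt) : option Fld :=
  match c with
  | SLoad _ _ f | SStore _ f _ => Some f
  | _ => None
  end.

Definition stmt_callee (c : stmt) : option Meth :=
  if c is SCall _ m _ then Some m else None.

Definition is_alloc (c : stmt) : bool :=
  if c is SAlloc _ _ then true else false.

(* Control flow is not modelled: a body is a finite set of statements. *)
Record lib_fun : Type := LibFun {
  lf_param : Var;
  lf_ret : Var;
  lf_body : {fset stmt}
}.

Definition library := {fmap Meth -> lib_fun}.

Definition program_over (VP : {fset Var}) (Ms : {fset Meth})
    (P : {fset stmt}) : Prop :=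
  forall c, c \in P ->
    {subset stmt_vars c <= VP} /\
    (forall m, stmt_callee c = Some m -> m \in Ms).

Definition lib_stmt (L : library) (c : stmt) : Prop :=
  exists m F, L.[? m] = Some F /\ c \in lf_body F.

Definition lib_vars_disjoint (VP : {fset Var}) (L : library) : Prop :=
  (forall m F, L.[? m] = Some F ->
     lf_param F \notin VP /\ lf_ret F \notin VP) /\
  (forall c x, lib_stmt L c -> x \in stmt_vars c -> x \notin VP).

Definition lib_no_alloc (L : library) : Prop :=
  forall c, lib_stmt L c -> ~~ is_alloc c.

Definition disjoint_fields (P : {fset stmt}) (L : library) : Prop :=
  forall c c' f, c \in P -> lib_stmt L c' ->
    stmt_field c = Some f -> stmt_field c' <> Some f.

Definition no_callbacks (L : library) : Prop :=
  forall c m, lib_stmt L c -> stmt_callee c = Some m -> m \in domf L.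

(* An abstract object is an allocation statement: this is the set O. *)
Definition alloc_stmts (P : {fset stmt}) : {fset stmt} :=
  [fset c in P | is_alloc c].

Definition call_stmts (Ms : {fset Meth}) (P : {fset stmt}) : {fset stmt} :=
  [fset c in P | if stmt_callee c is Some m then m \in Ms else false].

(* Concrete objects are natural numbers and None is the null reference.       *)
(* [site s l = Some o] says that l was allocated at the statement o, and      *)
(* [site s l = None] that l has not been allocated yet.                       *)
Record state : Type := State {
  env : Var -> option nat;
  heap : nat -> Fld -> option nat;
  site : nat -> option stmt
}.

Definition init_state : state :=
  State (fun=> None) (fun _ _ => None) (fun=> None).

Definition set_var (s : state) (x : Var) (v : option nat) : state :=
  State (fun z => if z == x then v else env s z) (heap s) (site s).

Definition set_field (s : state) (l : nat) (f : Fld) (v : option nat) : state :=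
  State (env s)
    (fun k g => if (k == l) && (g == f) then v else heap s k g) (site s).

Definition new_object (s : state) (l : nat) (o : stmt) : state :=
  State (env s)
    (fun k g => if k == l then None else heap s k g)
    (fun k => if k == l then Some o else site s k).

(* Dereferencing null has no successor state. Running a body means running    *)
(* any finite sequence of its statements. Library variables are global: they  *)
(* keep their values between calls.                                           *)
Inductive exec (L : library) : stmt -> state -> state -> Prop :=
| exec_alloc x X s l of site s l = None :
    exec L (SAlloc x X) s (set_var (new_object s l (SAlloc x X)) x (Some l))
| exec_assign x y s :
    exec L (SAssign x y) s (set_var s x (env s y))
| exec_load x y f s l of env s y = Some l :
    exec L (SLoad x y f) s (set_var s x (heap s l f))
| exec_store x f y s l of env s x = Some l :
    exec L (SStore x f y) s (set_field s l f (env s y))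
| exec_call x m y F s s' of
    L.[? m] = Some F &
    exec_body L (lf_body F) (set_var s (lf_param F) (env s y)) s' :
    exec L (SCall x m y) s (set_var s' x (env s' (lf_ret F)))
with exec_body (L : library) : {fset stmt} -> state -> state -> Prop :=
| exec_body_nil B s : exec_body L B s s
| exec_body_cons B c s s' s'' of
    c \in B & exec L c s s' & exec_body L B s' s'' : exec_body L B s s''.

(* Each executed statement of the program, with the state reached after it. *)
Definition trace := seq (stmt * state).

Fixpoint run_from (P : {fset stmt}) (L : library) (s : state) (t : trace) :
    Prop :=
  if t is (c, s') :: t' then [/\ c \in P, exec L c s s' & run_from P L s' t']
  else True.

Definition execution (P : {fset stmt}) (L : library) (t : trace) : Prop :=
  run_from P L init_state t.

(* Points inside a library call are omitted: library code does not write the  *)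
(* program variables, so these points contribute no edges.                    *)
Definition point_of (t : trace) (s : state) : Prop :=
  s = init_state \/ exists c, List.In (c, s) t.

Definition dynamic_edge (VP : {fset Var}) (P : {fset stmt}) (t : trace)
    (x : Var) (o : stmt) : Prop :=
  [/\ x \in VP, o \in alloc_stmts P &
      exists s l, [/\ point_of t s, env s x = Some l & site s l = Some o]].

Inductive computed (P : {fset stmt}) (Pi_miss : {fset Var * stmt}) :
    Var -> stmt -> Prop :=
| computed_alloc x X of SAlloc x X \in P : computed P Pi_miss x (SAlloc x X)
| computed_assign x y o of
    SAssign x y \in P & computed P Pi_miss y o : computed P Pi_miss x o
| computed_heap x y z w f o o' of
    SLoad x y f \in P & SStore z f w \in P &
    computed P Pi_miss y o' & computed P Pi_miss z o' &
    computed P Pi_miss w o : computed P Pi_miss x o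
| computed_miss x o of (x, o) \in Pi_miss : computed P Pi_miss x o.

Definition counterexample (VP : {fset Var}) (P : {fset stmt})
    (Pi : Var -> stmt -> Prop) (t : trace) (x : Var) (o : stmt) : Prop :=
  dynamic_edge VP P t x o /\ ~ Pi x o.

Definition monitoring_scheme (P M : {fset stmt}) : Prop :=
  M `<=` P /\ forall c, c \in M -> stmt_target c <> None.

(* Nothing is recorded when the target is null after the statement. *)
Definition recorded (M : {fset stmt}) (t : trace) (c : stmt) (l : nat) : Prop :=
  exists x s,
    [/\ List.In (c, s) t, c \in M, stmt_target c = Some x & env s x = Some l].

(* What the records reveal about allocation sites; [site] is not consulted. *)
Definition revealed (M : {fset stmt}) (t : trace) (l : nat) (o : stmt) : Prop :=
  is_alloc o /\ recorded M t o l.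

Definition detected (M : {fset stmt}) (t : trace) (x : Var) (o : stmt) : Prop :=
  exists c l,
    [/\ stmt_target c = Some x, recorded M t c l & revealed M t l o].

Definition reported (Pi : Var -> stmt -> Prop) (M : {fset stmt}) (t : trace)
    (x : Var) (o : stmt) : Prop :=
  detected M t x o /\ ~ Pi x o.

Definition sound (VP : {fset Var}) (P : {fset stmt}) (L : library)
    (Pi : Var -> stmt -> Prop) (M : {fset stmt}) : Prop :=
  forall t, execution P L t ->
    ((exists x o, counterexample VP P Pi t x o) ->
     exists x o, counterexample VP P Pi t x o /\ reported Pi M t x o) /\
    (forall x o, reported Pi M t x o -> counterexample VP P Pi t x o).

End Statements.

(* Main.v *)
(** Library code allocates nothing and touches neither program variables nor
    program fields, so a call affects the program-visible state only through
    the value it returns.  Every object a variable can point to was allocated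
    by a monitored statement of the program, hence is revealed; so if every
    edge created by the result of a call is already in the computed set, the
    rules of the static analysis account for all other program statements, and
    no counterexample occurs at all.  Conversely, allocation sites never change
    once set, so the edges detected from the records really occur. *)
Require Import Defs.
From Stdlib Require List.
From Stdlib Require Import Classical.
From mathcomp Require Import all_boot finmap.

Local Open Scope fset_scope.

Set Implicit Arguments.
Unset Strict Implicit.

Scheme exec_exec_body_ind := Minimality for exec Sort Prop
  with exec_body_exec_ind := Minimality for exec_body Sort Prop.
Combined Scheme exec_mutind from exec_exec_body_ind, exec_body_exec_ind.

Section Semantics.

Context {Var Cls Fld Meth : choiceType}.
Implicit Types (VP : {fset Var}) (P M B : {fset stmt Var Cls Fld Meth}).
Implicit Types (L : library Var Cls Fld Meth) (s : state Var Cls Fld Meth).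
Implicit Types (c o : stmt Var Cls Fld Meth) (t : trace Var Cls Fld Meth).

(** Allocation only asks for a location without a site. This invariant ensures that a location in
    use always has one, hence cannot be allocated again. *)
Definition no_dangling s : Prop :=
  (forall x l, env s x = Some l -> site s l <> None) /\
  (forall k f l, heap s k f = Some l -> site s l <> None).

Definition site_le s s' : Prop :=
  forall l o, site s l = Some o -> site s' l = Some o.

Definition program_field P (f : Fld) : Prop :=
  exists2 c, c \in P & stmt_field c = Some f.

(** Only program fields are compared, since library code may write its own fields of objects created
    by the program. *)
Definition same_program_view VP P s s' : Prop :=
  [/\ forall x, x \in VP -> env s' x = env s x,
      forall l f, program_field P f -> heap s' l f = heap s l f &
      site s' = site s].

Lemma site_le_refl s : site_le s s.
Proof. by move=> l o. Qed.

Lemma site_le_trans s1 s2 s3 :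
  site_le s1 s2 -> site_le s2 s3 -> site_le s1 s3.
Proof. by move=> le12 le23 l o /le12 /le23. Qed.

Lemma site_le_some s s' l :
  site_le s s' -> site s l <> None -> site s' l <> None.
Proof. by move=> le_ss'; case E: (site s l) => [o|//] _; rewrite (le_ss' _ _ E). Qed.

Lemma no_dangling_set_var s x v :
  no_dangling s -> (forall l, v = Some l -> site s l <> None) ->
  no_dangling (set_var s x v).
Proof.
by move=> [nd_env nd_heap] v_ok; split=> //= z l; case: eqP => _; [apply: v_ok|apply: nd_env].
Qed.

Lemma exec_no_dangling_site_le L :
  (forall c s s', exec L c s s' -> no_dangling s ->
     no_dangling s' /\ site_le s s') /\
  (forall B s s', exec_body L B s s' -> no_dangling s ->
     no_dangling s' /\ site_le s s').
Proof.
apply: exec_mutind.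
- move=> x X s l site_l [nd_env nd_heap].
  have le_new : site_le s (new_object s l (SAlloc Fld Meth x X)).
    by move=> k o /=; case: eqP => // ->; rewrite site_l.
  split=> //; apply: no_dangling_set_var; last by move=> k [<-] /=; rewrite eqxx.
  split=> [z k /nd_env|k f j /=]; first exact: site_le_some le_new.
  by case: ifP => // _ /nd_heap; apply: site_le_some le_new.
- move=> x y s nd; split=> //; apply: no_dangling_set_var => // l.
  exact: nd.1.
- move=> x y f s l _ nd; split=> //; apply: no_dangling_set_var => // k.
  exact: nd.2.
- move=> x f y s l _ nd; split=> //; split=> [|k g j] /=; first exact: nd.1.
  by case: ifP => _; [apply: nd.1|apply: nd.2].
- move=> x m y F s s' _ _ IH nd.
  have /IH[nd' le_ss'] : no_dangling (set_var s (lf_param F) (env s y)).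
    by apply: no_dangling_set_var => // l; apply: nd.1.
  by split=> //; apply: no_dangling_set_var => // l; apply: nd'.1.
- by move=> B s nd; split.
- move=> B c s s' s'' _ _ IHc _ IHB /IHc[/IHB[nd'' le_s's''] le_ss'].
  by split=> //; apply: site_le_trans le_s's''.
Qed.

Lemma same_program_view_trans VP P s1 s2 s3 :
  same_program_view VP P s1 s2 -> same_program_view VP P s2 s3 ->
  same_program_view VP P s1 s3.
Proof.
move=> [e12 h12 a12] [e23 h23 a23]; split=> [x xVP|l f Pf|].
- by rewrite e23 ?e12.
- by rewrite h23 ?h12.
- by rewrite a23.
Qed.

Lemma same_program_view_set_var VP P s x v :
  x \notin VP -> same_program_view VP P s (set_var s x v).
Proof. by move=> xVP; split=> //= z zVP; case: eqP zVP xVP => // -> ->. Qed.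

(** The first half handles nested calls inside the library, whose target is a library variable. A
    call made by the program writes a variable of [VP], so there only the second half applies, to
    the body. *)
Lemma exec_lib_same_program_view VP P L :
  lib_vars_disjoint VP L -> lib_no_alloc L -> disjoint_fields P L ->
  (forall c s s', exec L c s s' -> lib_stmt L c ->
     same_program_view VP P s s') /\
  (forall B s s', exec_body L B s s' -> (forall c, c \in B -> lib_stmt L c) ->
     same_program_view VP P s s').
Proof.
move=> [fun_vars stmt_vars] no_alloc fields; apply: exec_mutind => //.
- by move=> x X s l _ /no_alloc.
- move=> x y s libc; apply: same_program_view_set_var.
  by apply: stmt_vars libc _; rewrite inE eqxx.
- move=> x y f s l _ libc; apply: same_program_view_set_var.
  by apply: stmt_vars libc _; rewrite inE eqxx.
- move=> x f y s l _ libc; split=> //= k g [c cP cg].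
  case: ifP => // /andP[_ /eqP gf].
  by case: (fields _ _ _ cP libc cg); rewrite gf.
- move=> x m y F s s' mF _ IH libc.
  have [pVP _] := fun_vars _ _ mF.
  apply: same_program_view_trans (same_program_view_set_var P s (env s y) pVP) _.
  apply: same_program_view_trans (same_program_view_set_var _ _ _ _).
    by apply: IH => c cF; exists m, F.
  by apply: stmt_vars libc _; rewrite inE eqxx.
- move=> B c s s' s'' cB _ IHc _ IHB libB.
  by apply: same_program_view_trans (IHB libB); apply/IHc/libB.
Qed.

Definition final_state s t : state Var Cls Fld Meth :=
  last s [seq p.2 | p <- t].

Lemma run_from_site_le_final P L s t :
  run_from P L s t -> no_dangling s -> site_le s (final_state s t).
Proof.
elim: t s => [s _ _|[c s'] t IH s /= [_ ex run] nd]; first exact: site_le_refl.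
have [nd' le_ss'] := (exec_no_dangling_site_le L).1 _ _ _ ex nd.
exact: site_le_trans le_ss' (IH _ run nd').
Qed.

Lemma run_from_step P L s t c s' :
  run_from P L s t -> no_dangling s -> List.In (c, s') t ->
  [/\ no_dangling s', site_le s' (final_state s t) &
      exists s0, exec L c s0 s'].
Proof.
elim: t s => [|[c1 s1] t IH] s //= [_ ex run] nd.
have [nd1 _] := (exec_no_dangling_site_le L).1 _ _ _ ex nd.
case=> [[<- <-]|]; last exact: IH.
by split; [|exact: run_from_site_le_final run nd1|exists s].
Qed.

Lemma no_dangling_init : no_dangling (init_state Var Cls Fld Meth).
Proof. by []. Qed.

Lemma exec_alloc_site L o s s' x l :
  exec L o s s' -> is_alloc o -> stmt_target o = Some x -> env s' x = Some l ->
  site s' l = Some o.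
Proof.
by case=> // {}x0 X {}s {}k _ _ /= [<-]; rewrite eqxx => -[<-]; rewrite eqxx.
Qed.

(** The record of [x] and the one revealing the site of the object come in no known order, so both
    are compared with the final state. *)
Lemma detected_dynamic_edge VP Ms P L M t x o :
  program_over VP Ms P -> M `<=` P -> execution P L t ->
  detected M t x o -> dynamic_edge VP P t x o.
Proof.
move=> HP /fsubsetP MP run [c [l [cx [x1 [s [st cM]]]]]].
rewrite cx => -[<-{x1}] sx [alloc_o [y [s2 [s2t oM oy s2y]]]].
have [nd le_s _] := run_from_step run no_dangling_init st.
have [_ le_s2 [s0 ex]] := run_from_step run no_dangling_init s2t.
split.
- apply: (HP _ (MP _ cM)).1.
  by case: c cx {st cM} => //= [z X|z w|z w f|z m w] [->]; rewrite inE eqxx.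
- by rewrite !inE /= MP.
exists s, l; split=> //; first by right; exists c.
have := le_s2 _ _ (exec_alloc_site ex alloc_o oy s2y).
(* By [no_dangling], [l] already has a site when [x] is recorded; it persists to the end, where it
   has to be [o]. *)
case E: (site s l) (nd.1 _ _ sx) => [o1|//] _.
by rewrite (le_s _ _ E).
Qed.

(** The analysis keeps no edges for heap cells, so the content of a cell is justified by a store of
    the program together with the premises it contributes to the load-store rule. Neither [z] nor
    [w] need still point to these objects. *)
Definition covered VP P Pi_miss s : Prop :=
  (forall x l, x \in VP -> env s x = Some l ->
     exists2 o, site s l = Some o & computed P Pi_miss x o) /\
  (forall l f k, program_field P f -> heap s l f = Some k ->
     exists z w o' o, [/\ SStore Cls Meth z f w \in P,
       site s l = Some o', site s k = Some o,
       computed P Pi_miss z o' & computed P Pi_miss w o]).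

Lemma covered_set_var VP P Pi_miss s x v :
  covered VP P Pi_miss s ->
  (forall l, v = Some l ->
     exists2 o, site s l = Some o & computed P Pi_miss x o) ->
  covered VP P Pi_miss (set_var s x v).
Proof.
move=> [cov_env cov_heap] v_ok; split=> //= z l zVP.
by case: eqP => [-> /v_ok //|_]; apply: cov_env.
Qed.

(** Allocations and assignments have their own rule, a store is remembered until a load completes
    the heap rule, and calls have none: the hypothesis on [call_stmts] supplies the edge of the
    returned value. *)
Lemma exec_covered VP P L Pi_miss c s s' :
  program_over VP (domf L) P -> lib_vars_disjoint VP L -> lib_no_alloc L ->
  disjoint_fields P L ->
  (forall x l, c \in call_stmts (domf L) P -> stmt_target c = Some x ->
     env s' x = Some l ->
     exists2 o, site s' l = Some o & computed P Pi_miss x o) ->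
  c \in P -> exec L c s s' -> covered VP P Pi_miss s ->
  covered VP P Pi_miss s'.
Proof.
move=> HP HL no_alloc fields call_ok cP ex.
have cVP := (HP _ cP).1.
case: ex call_ok cP cVP => {c s s'}.
- move=> x X s l site_l _ cP cVP [cov_env cov_heap].
  have site_new k o : site s k = Some o ->
      site (new_object s l (SAlloc Fld Meth x X)) k = Some o.
    by rewrite /=; case: eqP => // ->; rewrite site_l.
  apply: covered_set_var; last first.
    by move=> k [<-]; exists (SAlloc Fld Meth x X) => /=; [rewrite eqxx|constructor].
  split=> [z k zVP /(cov_env _ _ zVP)[o /site_new]|k f j Pf]; first by exists o.
  (* The fields of the new object are null; older cells keep their justification. *)
  rewrite [heap _ _ _]/=; case: ifP => // _.
  move=> /(cov_heap _ _ _ Pf)[z [w [o' [o [? /site_new so' /site_new so ? ?]]]]].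
  by exists z, w, o', o.
- move=> x y s _ cP cVP cov; apply: covered_set_var => // l sy.
  have yVP : y \in VP by apply: cVP; rewrite !inE eqxx orbT.
  have [o so yo] := cov.1 _ _ yVP sy.
  by exists o => //; apply: computed_assign cP yo.
- move=> x y f s l sy _ cP cVP cov; apply: covered_set_var => // k sk.
  have yVP : y \in VP by apply: cVP; rewrite !inE eqxx orbT.
  have [o1 so1 yo1] := cov.1 _ _ yVP sy.
  have Pf : program_field P f by exists (SLoad Cls Meth x y f).
  have [z [w [o' [o [stP so' so zo' wo]]]]] := cov.2 _ _ _ Pf sk.
  (* The abstract objects [o1] of the load and [o'] of the store are both the site of [l], so the
     heap rule applies. *)
  exists o => //; move: so'; rewrite so1 => -[o1o'].
  by rewrite -o1o' in zo'; apply: computed_heap cP stP yo1 zo' wo.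
- move=> x f y s l sx _ cP cVP [cov_env cov_heap]; split=> //= k g j Pg.
  case: ifP => [/andP[/eqP-> /eqP->] sy|_]; last exact: cov_heap.
  have xVP : x \in VP by apply: cVP; rewrite !inE eqxx.
  have yVP : y \in VP by apply: cVP; rewrite !inE eqxx orbT.
  have [o' so' xo'] := cov_env _ _ xVP sx.
  have [o so yo] := cov_env _ _ yVP sy.
  by exists x, y, o', o.
- move=> x m y F s s' mF body call_ok cP cVP [cov_env cov_heap].
  have [_ view_body] := exec_lib_same_program_view HL no_alloc fields.
  have [pVP _] := HL.1 _ _ mF.
  (* Passing the argument and running the body are invisible to the program; only the final
     assignment to [x] is left for [call_ok]. *)
  have [e h a] : same_program_view VP P s s'.
    apply: same_program_view_trans (same_program_view_set_var P s (env s y) pVP) _.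
    by apply: view_body body _ => c cF; exists m, F.
  apply: covered_set_var.
    split=> [z l zVP|l f k Pf]; rewrite a; first by rewrite e //; apply: cov_env.
    by rewrite h //; apply: cov_heap.
  move=> l ret_l; apply: (call_ok x l) => //=; last by rewrite eqxx.
  by rewrite !inE cP /= -fndSome mF.
Qed.

(** A call leaves [site] unchanged, so a new site can only come from an allocation of the program
    itself, which a monitor can record. *)
Lemma exec_program_site VP P L c s s' l o :
  lib_vars_disjoint VP L -> lib_no_alloc L -> disjoint_fields P L ->
  exec L c s s' -> site s' l = Some o ->
  site s l = Some o \/
  exists x, [/\ is_alloc c, stmt_target c = Some x, env s' x = Some l & c = o].
Proof.
move=> HL no_alloc fields; case=> {c s s'}.
- move=> x X s k _ /=; case: eqP => [-> [<-]|_ ->]; last by left.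
  by right; exists x; rewrite eqxx.
- by left.
- by left.
- by left.
- move=> x m y F s s' mF body /= so; left.
  have [_ view_body] := exec_lib_same_program_view HL no_alloc fields.
  have [|_ _ <- //] := view_body _ _ _ body.
  by move=> c cF; exists m, F.
Qed.

(** Records are looked up in the whole trace [t], while the induction runs over a part [t1] of it.
    Carrying along that every allocated object is revealed in [t] turns each non-null value returned
    by a call into a detected edge. *)
Lemma run_covered VP P L Pi_miss M t t1 s :
  program_over VP (domf L) P -> lib_vars_disjoint VP L -> lib_no_alloc L ->
  disjoint_fields P L ->
  alloc_stmts P `<=` M -> call_stmts (domf L) P `<=` M ->
  (forall x o, detected M t x o -> computed P Pi_miss x o) ->
  run_from P L s t1 -> List.incl t1 t -> no_dangling s ->
  (forall l o, site s l = Some o -> revealed M t l o) ->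
  covered VP P Pi_miss s ->
  forall c s', List.In (c, s') t1 -> covered VP P Pi_miss s'.
Proof.
move=> HP HL no_alloc fields /fsubsetP allocM /fsubsetP callM det_ok.
elim: t1 s => [|[c1 s1] t1 IH] s //= [c1P ex run] sub nd rev cov.
have s1t : List.In (c1, s1) t by apply: sub; left.
have [nd1 _] := (exec_no_dangling_site_le L).1 _ _ _ ex nd.
have rev1 l o : site s1 l = Some o -> revealed M t l o.
  case/(exec_program_site HL no_alloc fields ex) => [/rev //|].
  move=> [x [alloc_c1 c1x s1x <-]]; split=> //; exists x, s1; split=> //.
  by apply: allocM; rewrite !inE c1P.
have cov1 : covered VP P Pi_miss s1.
  apply: exec_covered HP HL no_alloc fields _ c1P ex cov.
  move=> x l callc c1x s1x.
  case E: (site s1 l) (nd1.1 _ _ s1x) => [o|//] _; exists o => //.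
  apply: det_ok; exists c1, l; split=> //; last exact: rev1.
  by exists x, s1; split=> //; apply: callM.
move=> c s' [[_ <-] //|]; apply: IH run _ nd1 rev1 cov1 _ _ => p pt.
by apply: sub; right.
Qed.

End Semantics.

Theorem proposition1 (Var Cls Fld Meth : choiceType)
    (VP : {fset Var}) (P : {fset stmt Var Cls Fld Meth})
    (L : library Var Cls Fld Meth)
    (Pi_miss : {fset Var * stmt Var Cls Fld Meth})
    (HP : program_over VP (domf L) P)
    (HL : lib_vars_disjoint VP L)
    (Hnoalloc : lib_no_alloc L)
    (Hfields : disjoint_fields P L)
    (Hcallbacks : no_callbacks L)
    (Hmiss : Pi_miss `<=` VP `*` alloc_stmts P) :
  let M_min := alloc_stmts P `|` call_stmts (domf L) P in
  monitoring_scheme P M_min /\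
  sound VP P L (computed P Pi_miss) M_min.
Proof.
move=> M.
have MP : M `<=` P.
  by apply/fsubsetP => c; rewrite !inE /= => /orP[] /andP[].
split.
  split=> // c; rewrite !inE /= => /orP[] /andP[_].
    by case: c.
  by case: c.
move=> t run.
have only_cex x o : reported (computed P Pi_miss) M t x o ->
    counterexample VP P (computed P Pi_miss) t x o.
  by move=> [det nPi]; split=> //; apply: detected_dynamic_edge HP MP run det.
split=> // -[x [o [[xVP _ [s [l [pt sx so]]]] nPi]]].
(* The edge reported may differ from the given one, and no witness is constructed: if nothing were
   reported, every detected edge would be computed, and then the given one too. *)
apply: NNPP => no_report; apply: nPi.
have det_ok y o' : detected M t y o' -> computed P Pi_miss y o'.
  move=> det; apply: NNPP => nPi; apply: no_report; exists y, o'.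
  have rep : reported (computed P Pi_miss) M t y o' by [].
  by split=> //; apply: only_cex.
have cov : covered VP P Pi_miss s.
  case: pt => [->|[c st]]; first by [].
  apply: (run_covered HP HL Hnoalloc Hfields _ _ det_ok run _ _ _ _ st) => //.
  - exact: fsubsetUl.
  - exact: fsubsetUr.
have [o1] := cov.1 _ _ xVP sx.
by rewrite so => -[<-].
Qed.
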